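(* Let $h$ be analytic in $\mathbb{D}$ and continuous in $\overline{\mathbb{D}}$. If $0 \leq r \leq 1/3$, then $$\mathcal{M}_{r}(h\circ\varphi) \leq \|h\|_{\infty}$$ for every Schwarz function $\varphi$.
   Context: $\mathbb{D}=\{z\in\mathbb{C}:|z|<1\}$ and $\overline{\mathbb{D}}$ is its closure. For an analytic function $f(z)=\sum_{n=0}^{\infty}a_nz^n$ in $\mathbb{D}$ and $0\le r<1$, the Bohr operator is $\mathcal{M}_r(f)=\sum_{n=0}^{\infty}|a_n|r^n$ (with the convention $0^0=1$). A Schwarz function is an analytic function $\varphi$ on $\mathbb{D}$ with $\varphi(0)=0$ and $|\varphi(z)|\le 1$ for all $z\in\mathbb{D}$. $\|h\|_\infty$ denotes the sup-norm of $h$ (supremum of $|h|$ on $\overline{\mathbb{D}}$). *)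

(* Defs.v *)
From Stdlib Require Import Reals ClassicalEpsilon.
From Coquelicot Require Import Coquelicot.
Open Scope R_scope.

Definition unit_disc (z : C) : Prop := Cmod z < 1.

Definition closed_unit_disc (z : C) : Prop := Cmod z <= 1.

Definition has_expansion (f : C -> C) (c : C) (rho : R) (a : nat -> C) : Prop :=
  forall z : C, Cmod (z - c)%C < rho ->
    is_pseries (K := C_AbsRing) (V := C_NormedModule) a (z - c)%C (f z).

(* Functions are total on C; only their values on the relevant disc matter. *)
Definition analytic_in_disc (f : C -> C) : Prop :=
  forall c : C, unit_disc c ->
    exists (rho : R) (a : nat -> C), 0 < rho /\ has_expansion f c rho a.

Definition schwarz_function (phi : C -> C) : Prop :=
  analytic_in_disc phi /\ phi (RtoC 0) = RtoC 0 /\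
  (forall z : C, unit_disc z -> Cmod (phi z) <= 1).

(* The sequence (a_n) with f(z) = sum a_n z^n on the whole unit disc. For f
   analytic in the disc it exists and is unique; otherwise it is arbitrary. *)
Definition coefficients (f : C -> C) : nat -> C :=
  epsilon (inhabits (fun _ : nat => RtoC 0)) (has_expansion f (RtoC 0) 1).

(* The terms are nonnegative, so the limit of the partial sums exists in Rbar;
   it is p_infty when the series diverges (unlike Series, which is real-valued).
   Here r ^ 0 = 1 also for r = 0. *)
Definition bohr_operator (r : R) (f : C -> C) : Rbar :=
  Lim_seq (sum_n (fun n : nat => Cmod (coefficients f n) * r ^ n)).

Definition sup_norm (h : C -> C) : Rbar :=
  Lub_Rbar (fun y : R => exists z : C, closed_unit_disc z /\ y = Cmod (h z)).

(* Main.v *)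
Require Import Defs.
From Stdlib Require Import Reals Arith Lra Lia Classical ClassicalEpsilon.
From Coquelicot Require Import Coquelicot.
Open Scope R_scope.

(** Let [M] be the supremum of [|h|] on the closed disc. The composition
    [g = h o phi] is analytic in the disc and bounded there by [M], so everything
    reduces to Bohr's theorem: if [g(z) = sum a_n z^n] and [|g| <= M], then
    [sum |a_n| r^n <= M] for [r <= 1/3]. That theorem follows from Caratheodory's
    inequality [|a_n| <= 2 (M - |a_0|)] for [n >= 1] (a consequence of
    [Re (u g) <= M] for a unimodular [u] with [u a_0 = |a_0|]) and from
    [2 (1/3 + 1/9 + ...) = 1]; see [caratheodory_circle] and
    [coefficient_sum_le].

    The remaining work is to show that [g] has one power series valid on the
    whole disc, while analyticity only provides local ones. Contour integrals
    are replaced by averages over roots of unity. For a polynomial and enough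
    sample points such averages return coefficients exactly, and a convergent
    power series is a uniform limit of polynomials on smaller circles. This
    gives Cauchy's estimate ([cauchy_circle]) and, from it, the fact that locally
    uniform limits of power series are power series ([weierstrass]).

    Two consequences finish the proof. A function with local expansions
    everywhere has a global one ([analytic_power_sum]): by compactness the
    expansions at all points of [|c| <= s < 1] have a common radius [d] and a
    common bound, and two nested Cauchy estimates show that a series at 0 with
    radius [rho <= s] in fact has radius at least [rho + d]
    ([power_sum_extend]). And [h o phi] is the limit of
    the partial sums of [h] evaluated at [phi], locally uniformly because
    [|phi z| <= |z|] ([schwarz_lemma], [expandable_comp_schwarz]). *)

(** * Convergence of complex sequences and power series *)

(** The uniform structure of [C] is that of a product, for which balls are
    squares; the estimates below are in terms of the modulus. *)
Definition tends (u : nat -> C) (l : C) : Prop :=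
  forall eps, 0 < eps -> eventually (fun n => Cmod (u n - l) < eps).

Definition csum (u : nat -> C) (N : nat) : C := sum_n (G := C_AbelianMonoid) u N.

Definition psum (a : nat -> C) (w : C) (N : nat) : C :=
  csum (fun n => a n * w ^ n)%C N.

(** The variable is the displacement from the centre of expansion; expansions at
    another point [c] are those of [fun w => f (c + w)]. *)
Definition power_sum (a : nat -> C) (rho : R) (f : C -> C) : Prop :=
  forall w, Cmod w < rho -> tends (psum a w) (f w).

Lemma csum_0 u : csum u 0 = u O.
Proof. exact (sum_O (G := C_AbelianMonoid) u). Qed.

Lemma csum_S u N : csum u (S N) = (csum u N + u (S N))%C.
Proof. exact (sum_Sn (G := C_AbelianMonoid) u N). Qed.

Lemma psum_0 a w : psum a w 0 = a O.
Proof. unfold psum. rewrite csum_0. simpl. ring. Qed.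

Lemma psum_S a w N : psum a w (S N) = (psum a w N + a (S N) * w ^ S N)%C.
Proof. apply csum_S. Qed.

Lemma pow_n_Cpow (z : C) n : pow_n (K := C_Ring) z n = (z ^ n)%C.
Proof. induction n as [|n IH]; [reflexivity|]. simpl. rewrite IH. reflexivity. Qed.

Lemma tends_filterlim u l :
  tends u l <-> filterlim u eventually (locally (T := C_UniformSpace) l).
Proof.
  rewrite (filterlim_locally_ball_norm (K := C_AbsRing) (U := C_NormedModule) u l).
  split.
  - intros H eps. exact (H eps (cond_pos eps)).
  - intros H eps He. exact (H (mkposreal eps He)).
Qed.

Lemma power_sum_pseries a rho f :
  power_sum a rho f <->
  forall w, Cmod w < rho ->
    is_pseries (K := C_AbsRing) (V := C_NormedModule) a w (f w).
Proof.
  assert (E : forall w l, tends (psum a w) l <->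
    is_pseries (K := C_AbsRing) (V := C_NormedModule) a w l).
  { intros w l. rewrite tends_filterlim. unfold is_pseries, is_series.
    assert (E : forall N, psum a w N =
      sum_n (G := C_AbelianMonoid)
        (fun k => @scal C_AbsRing C_NormedModule (pow_n (K := C_Ring) w k) (a k)) N).
    { intros N. unfold psum, csum. apply sum_n_ext. intros n.
      rewrite <- pow_n_Cpow. apply Cmult_comm. }
    split; apply filterlim_ext; intros N; [exact (E N)|exact (eq_sym (E N))]. }
  split; intros H w Hw; apply E, H, Hw.
Qed.

Lemma has_expansion_power_sum f c rho a :
  has_expansion f c rho a <-> power_sum a rho (fun w => f (c + w)%C).
Proof.
  rewrite power_sum_pseries. split; intros H w Hw.
  - generalize (H (c + w)%C). replace (c + w - c)%C with w by ring. auto.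
  - generalize (H (w - c)%C Hw). replace (c + (w - c))%C with w by ring. auto.
Qed.

Lemma Cmod_triangle3 x y z : Cmod (x - z) <= Cmod (x - y) + Cmod (y - z).
Proof.
  replace (x - z)%C with ((x - y) + (y - z))%C by ring. apply Cmod_triangle.
Qed.

Lemma Cmod_minus_sym x y : Cmod (x - y) = Cmod (y - x).
Proof. rewrite <- Cmod_opp. f_equal. ring. Qed.

Lemma Cmod_sub_le x y : Cmod x <= Cmod y + Cmod (x - y).
Proof.
  replace x with (y + (x - y))%C at 1 by ring. apply Cmod_triangle.
Qed.

Lemma tends_ext u v l : (forall n, u n = v n) -> tends u l -> tends v l.
Proof.
  intros E H eps He. apply filter_imp with (2 := H eps He).
  intros n. rewrite E. auto.
Qed.

Lemma tends_plus u v l m :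
  tends u l -> tends v m -> tends (fun n => u n + v n)%C (l + m)%C.
Proof.
  intros Hu Hv eps He.
  assert (He2 : 0 < eps / 2) by lra.
  apply filter_imp with (2 := filter_and _ _ (Hu _ He2) (Hv _ He2)).
  intros n [H1 H2].
  replace (u n + v n - (l + m))%C with ((u n - l) + (v n - m))%C by ring.
  eapply Rle_lt_trans; [apply Cmod_triangle|lra].
Qed.

Lemma tends_mult_l k u l : tends u l -> tends (fun n => k * u n)%C (k * l)%C.
Proof.
  intros Hu eps He. pose proof (Cmod_ge_0 k).
  assert (He2 : 0 < eps / (Cmod k + 1)) by (apply Rdiv_lt_0_compat; lra).
  apply filter_imp with (2 := Hu _ He2). intros n H1.
  replace (k * u n - k * l)%C with (k * (u n - l))%C by ring.
  rewrite Cmod_mult. apply Rlt_div_r in H1; [|lra].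
  pose proof (Cmod_ge_0 (u n - l)). nra.
Qed.

Lemma tends_le u l B :
  tends u l -> eventually (fun n => Cmod (u n) <= B) -> Cmod l <= B.
Proof.
  intros Hu HB. apply le_epsilon. intros eps He.
  destruct (filter_ex _ (filter_and _ _ (Hu eps He) HB)) as [n [H1 H2]].
  pose proof (Cmod_sub_le l (u n)). rewrite Cmod_minus_sym in H. lra.
Qed.

Lemma tends_unique u l m : tends u l -> tends u m -> l = m.
Proof.
  intros Hl Hm.
  assert (E : Cmod (l - m) <= 0).
  { apply le_epsilon. intros eps He.
    assert (He2 : 0 < eps / 2) by lra.
    destruct (filter_ex _ (filter_and _ _ (Hl _ He2) (Hm _ He2))) as [n [H1 H2]].
    pose proof (Cmod_triangle3 l (u n) m) as H.
    rewrite (Cmod_minus_sym l (u n)) in H. lra. }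
  pose proof (Cmod_ge_0 (l - m)).
  assert (E0 : (l - m)%C = 0) by (apply Cmod_eq_0; lra).
  replace l with ((l - m) + m)%C by ring. rewrite E0. ring.
Qed.

Lemma tends_const l : tends (fun _ => l) l.
Proof.
  intros eps He. apply filter_forall. intros n.
  replace (l - l)%C with (RtoC 0) by ring. rewrite Cmod_0. exact He.
Qed.

Lemma tends_shift_index u l k : tends (fun n => u (n + k)%nat) l <-> tends u l.
Proof.
  split; intros H eps He; destruct (H eps He) as [N HN].
  - exists (N + k)%nat. intros n Hn. replace n with ((n - k) + k)%nat by lia.
    apply HN. lia.
  - exists N. intros n Hn. apply HN. lia.
Qed.

Lemma tends_cauchy u :
  (forall eps, 0 < eps ->
     exists N, forall n m, (N <= n)%nat -> (N <= m)%nat -> Cmod (u n - u m) <= eps) ->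
  exists l, tends u l.
Proof.
  intros H.
  destruct (proj1 (filterlim_locally_cauchy (U := C_CompleteNormedModule)
    (F := eventually) u)) as [l Hl].
  - intros eps.
    destruct (H (eps / 2)) as [N HN]; [destruct eps; simpl; lra|].
    exists (fun n => (N <= n)%nat). split; [exists N; auto|].
    intros n m Hn Hm. apply C_NormedModule_mixin_compat1.
    apply Rle_lt_trans with (eps / 2); [|destruct eps; simpl; lra].
    exact (HN m n Hm Hn).
  - exists l. apply tends_filterlim. exact Hl.
Qed.

(** Estimates are first obtained on circles strictly inside the disc of
    convergence; this carries them to the boundary radius. *)
Lemma pow_le_limit x M R0 n :
  0 < R0 -> (forall s, 0 < s < R0 -> x * s ^ n <= M) -> x * R0 ^ n <= M.
Proof.
  intros HR H.
  set (u := fun m : nat => R0 * (1 - / (INR m + 2))).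
  assert (Hu : is_lim_seq u (R0 * (1 - 0))).
  { apply (is_lim_seq_scal_l _ R0 (1 - 0)).
    apply is_lim_seq_minus'; [apply is_lim_seq_const|].
    replace (Finite 0) with (Rbar_inv p_infty) by reflexivity.
    apply is_lim_seq_inv; [|discriminate].
    eapply is_lim_seq_plus; [apply is_lim_seq_INR|apply is_lim_seq_const|].
    reflexivity. }
  replace (R0 * (1 - 0)) with R0 in Hu by ring.
  assert (Hc : is_lim_seq (fun m => x * u m ^ n) (x * R0 ^ n)).
  { apply (is_lim_seq_continuous (fun y => x * y ^ n)); [|exact Hu].
    reg. }
  change (Rbar_le (x * R0 ^ n) M).
  apply is_lim_seq_le with (2 := Hc) (3 := is_lim_seq_const M).
  intros m. apply H. unfold u. pose proof (pos_INR m).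
  assert (0 < / (INR m + 2) < 1).
  { split; [apply Rinv_0_lt_compat; lra|].
    rewrite <- Rinv_1. apply Rinv_lt_contravar; lra. }
  nra.
Qed.

(** * Geometric bounds *)

(** Keeping the subtracted term [q ^ S (D + k)] of the geometric sum is what
    makes the induction on the number [k] of extra terms close. *)
Lemma psum_increment_sharp a B q t w :
  0 < t -> 0 <= q < 1 -> Cmod w <= q * t -> (forall n, Cmod (a n) * t ^ n <= B) ->
  forall D k, Cmod (psum a w (D + k) - psum a w D)
    <= B * (q ^ S D - q ^ S (D + k)) / (1 - q).
Proof.
  intros Ht Hq Hw Ha D. induction k as [|k IH].
  - rewrite Nat.add_0_r. replace (psum a w D - psum a w D)%C with (RtoC 0) by ring.
    rewrite Cmod_0. right. field. lra.
  - rewrite Nat.add_succ_r, psum_S.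
    set (m := (D + k)%nat) in *.
    assert (T : Cmod (a (S m) * w ^ S m) <= B * q ^ S m).
    { rewrite Cmod_mult, Cmod_pow.
      apply Rle_trans with (Cmod (a (S m)) * (q * t) ^ S m).
      - apply Rmult_le_compat_l; [apply Cmod_ge_0|].
        apply pow_incr. split; [apply Cmod_ge_0|exact Hw].
      - rewrite Rpow_mult_distr.
        replace (Cmod (a (S m)) * (q ^ S m * t ^ S m))
          with (Cmod (a (S m)) * t ^ S m * q ^ S m) by ring.
        apply Rmult_le_compat_r; [apply pow_le; lra|apply Ha]. }
    replace (psum a w m + a (S m) * w ^ S m - psum a w D)%C
      with ((psum a w m - psum a w D) + a (S m) * w ^ S m)%C by ring.
    eapply Rle_trans; [apply Cmod_triangle|].
    eapply Rle_trans; [apply Rplus_le_compat; [exact IH|exact T]|].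
    right. simpl. field. lra.
Qed.

Lemma psum_increment_bound a B q t w :
  0 < t -> 0 <= q < 1 -> Cmod w <= q * t -> (forall n, Cmod (a n) * t ^ n <= B) ->
  forall D n, (D <= n)%nat -> Cmod (psum a w n - psum a w D) <= B * q ^ S D / (1 - q).
Proof.
  intros Ht Hq Hw Ha D n HD.
  replace n with (D + (n - D))%nat by lia.
  eapply Rle_trans; [apply (psum_increment_sharp a B q t w Ht Hq Hw Ha)|].
  assert (0 <= B).
  { eapply Rle_trans; [|apply (Ha O)]. simpl. rewrite Rmult_1_r. apply Cmod_ge_0. }
  unfold Rdiv. apply Rmult_le_compat_r.
  - left. apply Rinv_0_lt_compat. lra.
  - apply Rmult_le_compat_l; [assumption|].
    pose proof (pow_le q (S (D + (n - D))) (proj1 Hq)). lra.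
Qed.

Lemma psum_remainder_bound a B q t w l :
  0 < t -> 0 <= q < 1 -> Cmod w <= q * t -> (forall n, Cmod (a n) * t ^ n <= B) ->
  tends (psum a w) l ->
  forall D, Cmod (l - psum a w D) <= B * q ^ S D / (1 - q).
Proof.
  intros Ht Hq Hw Ha Hl D.
  apply tends_le with (fun n => psum a w n + - psum a w D)%C.
  - apply tends_plus; [exact Hl|apply tends_const].
  - exists D. intros n Hn. apply (psum_increment_bound a B q t w Ht Hq Hw Ha D n Hn).
Qed.

Lemma psum_bound a B q t w :
  0 < t -> 0 <= q < 1 -> Cmod w <= q * t -> (forall n, Cmod (a n) * t ^ n <= B) ->
  forall N, Cmod (psum a w N) <= B / (1 - q).
Proof.
  intros Ht Hq Hw Ha N.
  pose proof (psum_increment_bound a B q t w Ht Hq Hw Ha 0 N (Nat.le_0_l N)) as H.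
  rewrite psum_0 in H. specialize (Ha O). simpl in Ha, H.
  pose proof (Cmod_sub_le (psum a w N) (a O)).
  replace (B / (1 - q)) with (B + B * (q * 1) / (1 - q)) by (field; lra). lra.
Qed.

Lemma small_geometric K q : 0 <= q < 1 ->
  forall eps, 0 < eps -> eventually (fun D => K * q ^ S D < eps).
Proof.
  intros Hq eps He.
  assert (H : is_lim_seq (fun D => K * q ^ S D) 0).
  { replace (Finite 0) with (Rbar_mult K 0) by (simpl; f_equal; ring).
    apply is_lim_seq_scal_l. apply (is_lim_seq_incr_1 (fun n => q ^ n)).
    apply is_lim_seq_geom. rewrite Rabs_pos_eq; lra. }
  apply is_lim_seq_spec in H. destruct (H (mkposreal eps He)) as [N HN].
  exists N. intros n Hn. specialize (HN n Hn). simpl pos in HN.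
  rewrite Rminus_0_r in HN. apply Rabs_lt_between in HN. lra.
Qed.

Lemma ratio_bounds x t : 0 <= x < t -> 0 <= x / t < 1 /\ x <= x / t * t.
Proof.
  intros H. split; [split|].
  - apply Rdiv_le_0_compat; lra.
  - apply Rlt_div_l; lra.
  - right. field. lra.
Qed.

Lemma power_sum_terms_bounded a rho f t :
  power_sum a rho f -> 0 <= t < rho -> exists B, forall n, Cmod (a n) * t ^ n <= B.
Proof.
  intros H Ht.
  assert (Hc : Cmod t < rho) by (rewrite Cmod_R, Rabs_pos_eq; lra).
  apply H, tends_filterlim in Hc.
  destruct (filterlim_bounded (K := C_AbsRing) (V := C_NormedModule) (psum a t))
    as [M HM]; [eexists; exact Hc|].
  exists (M + M). intros n. change (forall n, Cmod (psum a t n) <= M) in HM.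
  replace (Cmod (a n) * t ^ n) with (Cmod (a n * t ^ n)).
  2:{ rewrite Cmod_mult, Cmod_pow, Cmod_R, Rabs_pos_eq; lra. }
  destruct n as [|n].
  - pose proof (HM O) as H0. rewrite psum_0 in H0. pose proof (Cmod_ge_0 (a O)).
    simpl. rewrite Cmult_1_r. lra.
  - pose proof (HM n). pose proof (HM (S n)) as H1.
    replace (a (S n) * t ^ S n)%C with (psum a t (S n) + - psum a t n)%C
      by (rewrite psum_S; ring).
    eapply Rle_trans; [apply Cmod_triangle|]. rewrite Cmod_opp. lra.
Qed.

Lemma power_sum_uniform a rho f s :
  power_sum a rho f -> 0 <= s < rho ->
  forall eps, 0 < eps ->
    eventually (fun D => forall w, Cmod w <= s -> Cmod (f w - psum a w D) < eps).
Proof.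
  intros H Hs eps He. set (t := (s + rho) / 2).
  assert (Ht : 0 <= s < t) by (unfold t; lra).
  destruct (power_sum_terms_bounded a rho f t H) as [B HB]; [unfold t; lra|].
  destruct (ratio_bounds s t Ht) as [Hq Hst].
  apply filter_imp with (2 := small_geometric (B / (1 - s / t)) (s / t) Hq eps He).
  intros D HD w Hw.
  eapply Rle_lt_trans; [|exact HD].
  replace (B / (1 - s / t) * (s / t) ^ S D) with (B * (s / t) ^ S D / (1 - s / t))
    by (unfold Rdiv; ring).
  apply psum_remainder_bound with t; try lra; auto. apply H. unfold t in Ht. lra.
Qed.

(** Converse of the boundedness of the terms: on each smaller disc the partial
    sums are Cauchy by comparison with a geometric series. *)
Lemma power_sum_of_bounds a rho :
  (forall t, 0 < t < rho -> exists B, forall n, Cmod (a n) * t ^ n <= B) ->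
  exists f, power_sum a rho f.
Proof.
  intros H.
  assert (L : forall w, exists l, Cmod w < rho -> tends (psum a w) l).
  { intros w. destruct (Rlt_dec (Cmod w) rho) as [Hw|Hw].
    2:{ exists (RtoC 0). intros. contradiction. }
    pose proof (Cmod_ge_0 w). set (t := (Cmod w + rho) / 2).
    destruct (H t) as [B HB]; [unfold t; lra|].
    destruct (ratio_bounds (Cmod w) t) as [Hq Hst]; [unfold t; lra|].
    set (q := Cmod w / t) in *.
    destruct (tends_cauchy (psum a w)) as [l Hl]; [|exists l; auto].
    intros eps He.
    destruct (small_geometric (B / (1 - q)) q Hq (eps / 2)) as [N HN]; [lra|].
    exists N. intros n m Hn Hm.
    assert (T : forall n, (N <= n)%nat -> Cmod (psum a w n - psum a w N) <= eps / 2).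
    { intros k Hk. eapply Rle_trans;
        [apply (psum_increment_bound a B q t w); try assumption; unfold t; lra|].
      specialize (HN N (Nat.le_refl N)).
      replace (B * q ^ S N / (1 - q)) with (B / (1 - q) * q ^ S N)
        by (unfold Rdiv; ring). lra. }
    pose proof (T n Hn). pose proof (T m Hm) as Tm. rewrite Cmod_minus_sym in Tm.
    pose proof (Cmod_triangle3 (psum a w n) (psum a w N) (psum a w m)). lra. }
  exists (fun w => proj1_sig (constructive_indefinite_description _ (L w))).
  intros w Hw. exact (proj2_sig (constructive_indefinite_description _ (L w)) Hw).
Qed.

(** * Averages over roots of unity *)

Definition cis (x : R) : C := (cos x, sin x).

Lemma cis_plus x y : cis (x + y) = (cis x * cis y)%C.
Proof.
  unfold cis, Cmult. simpl. rewrite cos_plus, sin_plus. f_equal. ring.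
Qed.

Lemma cis_0 : cis 0 = 1.
Proof. unfold cis. rewrite cos_0, sin_0. reflexivity. Qed.

Lemma cis_pow x n : (cis x ^ n)%C = cis (INR n * x).
Proof.
  induction n as [|n IH].
  - rewrite Rmult_0_l, cis_0. reflexivity.
  - rewrite S_INR, Rmult_plus_distr_r, Rmult_1_l, Rplus_comm, cis_plus, <- IH.
    reflexivity.
Qed.

Lemma cis_conj x : Cconj (cis x) = cis (- x).
Proof. unfold cis, Cconj. simpl. rewrite cos_neg, sin_neg. reflexivity. Qed.

Lemma Cmod_cis x : Cmod (cis x) = 1.
Proof.
  unfold Cmod, cis. simpl fst. simpl snd. rewrite <- sqrt_1. f_equal.
  pose proof (sin2_cos2 x) as H. unfold Rsqr in H. simpl. lra.
Qed.

(** By [cos x = 1 - 2 sin (x/2)^2], the value 1 is impossible as long as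
    [0 < |x/2| < PI]. *)
Lemma cis_neq_1 x : 0 < Rabs x < 2 * PI -> cis x <> 1.
Proof.
  intros Hx E.
  assert (Hc : cos (Rabs x) = 1).
  { replace (cos (Rabs x)) with (cos x).
    - exact (f_equal fst E).
    - unfold Rabs. destruct (Rcase_abs x); [symmetry; apply cos_neg|reflexivity]. }
  assert (Hs : 0 < sin (Rabs x / 2)) by (apply sin_gt_0; lra).
  replace (Rabs x) with (2 * (Rabs x / 2)) in Hc by field.
  rewrite cos_2a_sin in Hc. nra.
Qed.

Lemma cis_2PI : cis (2 * PI) = 1.
Proof. unfold cis. rewrite cos_2PI, sin_2PI. reflexivity. Qed.

Lemma csum_geom q N : (csum (fun j => q ^ j) N * (1 - q) = 1 - q ^ S N)%C.
Proof.
  induction N as [|N IH].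
  - rewrite csum_0. simpl. ring.
  - rewrite csum_S, Cmult_plus_distr_r, IH. simpl. ring.
Qed.

Lemma csum_ext u v N : (forall n, u n = v n) -> csum u N = csum v N.
Proof. intros E. apply sum_n_ext. exact E. Qed.

Lemma csum_plus u v N : csum (fun n => u n + v n)%C N = (csum u N + csum v N)%C.
Proof. exact (sum_n_plus (G := C_AbelianMonoid) u v N). Qed.

Lemma csum_mult_l k u N : csum (fun n => k * u n)%C N = (k * csum u N)%C.
Proof. exact (sum_n_mult_l (K := C_Ring) k u N). Qed.

Lemma csum_const k N : csum (fun _ => k) N = (INR (S N) * k)%C.
Proof.
  induction N as [|N IH].
  - rewrite csum_0. change (INR 1) with 1. ring.
  - rewrite csum_S, IH, (S_INR (S N)), RtoC_plus. ring.
Qed.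

Lemma csum_conj u N : csum (fun n => Cconj (u n)) N = Cconj (csum u N).
Proof.
  induction N as [|N IH].
  - rewrite !csum_0. reflexivity.
  - rewrite !csum_S, IH, Cplus_conj. reflexivity.
Qed.

Lemma Cmod_csum_le u v N :
  (forall n, Cmod (u n) <= Re (v n)) -> Cmod (csum u N) <= Re (csum v N).
Proof.
  intros H. induction N as [|N IH].
  - rewrite !csum_0. apply H.
  - rewrite !csum_S, re_plus. eapply Rle_trans; [apply Cmod_triangle|].
    specialize (H (S N)). lra.
Qed.

Definition root (N j : nat) : C := cis (INR j * (2 * PI / INR (S N))).

Definition average (N : nat) (F : C -> C) : C :=
  (RtoC (/ INR (S N)) * csum (fun j => F (root N j)) N)%C.

Lemma Cmod_root N j : Cmod (root N j) = 1.
Proof. apply Cmod_cis. Qed.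

Lemma INR_S_pos N : 0 < INR (S N).
Proof. apply lt_0_INR. lia. Qed.

Lemma average_ext N F G :
  (forall z, Cmod z = 1 -> F z = G z) -> average N F = average N G.
Proof.
  intros E. unfold average. f_equal. apply csum_ext. intros j. apply E, Cmod_root.
Qed.

Lemma average_plus N F G :
  average N (fun z => F z + G z)%C = (average N F + average N G)%C.
Proof. unfold average. rewrite csum_plus. ring. Qed.

Lemma average_mult_l N k F : average N (fun z => k * F z)%C = (k * average N F)%C.
Proof. unfold average. rewrite csum_mult_l. ring. Qed.

Lemma average_conj N F : average N (fun z => Cconj (F z)) = Cconj (average N F).
Proof.
  unfold average. rewrite csum_conj, Cmult_conj. f_equal.
  unfold Cconj, RtoC. simpl fst. simpl snd.
  rewrite Ropp_0. reflexivity.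
Qed.

(** Bounding the modulus by the real part of another average, instead of by an
    average of moduli, lets the right-hand side be evaluated by linearity. This
    is how the mean value property of [Re f] enters Caratheodory's inequality. *)
Lemma average_le N F G :
  (forall z, Cmod z = 1 -> Cmod (F z) <= Re (G z)) ->
  Cmod (average N F) <= Re (average N G).
Proof.
  intros H. pose proof (INR_S_pos N) as HN.
  assert (0 < / INR (S N)) by (apply Rinv_0_lt_compat; exact HN).
  unfold average. rewrite Cmod_mult, Cmod_R, Rabs_pos_eq, re_scal_l by lra.
  apply Rmult_le_compat_l; [lra|]. apply Cmod_csum_le.
  intros j. apply H, Cmod_root.
Qed.

(** Discrete orthogonality: for [m <> n] the sum is geometric with a ratio
    [q <> 1] such that [q ^ (N+1) = 1], because [0 < |m - n| < N + 1]. *)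
Lemma average_monomial N m n : (m <= N)%nat -> (n <= N)%nat ->
  average N (fun z => z ^ m * Cconj z ^ n)%C = if Nat.eq_dec m n then 1 else 0.
Proof.
  intros Hm Hn. pose proof (INR_S_pos N) as HN. pose proof PI_RGT_0 as Hpi.
  set (th := 2 * PI / INR (S N)).
  set (x := (INR m - INR n) * th).
  assert (E : forall j, (root N j ^ m * Cconj (root N j) ^ n)%C = (cis x ^ j)%C).
  { intros j. unfold root. rewrite cis_conj, !cis_pow, <- cis_plus.
    f_equal. unfold x, th. ring. }
  unfold average. rewrite (csum_ext _ _ N E).
  assert (HNC : RtoC (INR (S N)) <> 0) by (intros H; apply RtoC_inj in H; lra).
  destruct (Nat.eq_dec m n) as [->|Hmn].
  - assert (x0 : x = 0) by (unfold x; ring).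
    rewrite x0, cis_0, (csum_ext _ (fun _ => RtoC 1)) by (intros j; apply Cpow_1_l).
    rewrite csum_const, RtoC_inv by lra. field. exact HNC.
  - assert (Hx : cis x <> 1).
    { apply cis_neq_1. unfold x.
      assert (Hth : INR (S N) * th = 2 * PI) by (unfold th; field; lra).
      assert (0 < th) by (unfold th; apply Rdiv_lt_0_compat; lra).
      assert (Hd : 1 <= Rabs (INR m - INR n) < INR (S N)).
      { destruct (Nat.lt_ge_cases m n) as [L|L].
        - rewrite Rabs_minus_sym, Rabs_pos_eq; rewrite <- minus_INR by lia.
          + split; [apply (le_INR 1)|apply lt_INR]; lia.
          + apply pos_INR.
        - rewrite Rabs_pos_eq; rewrite <- minus_INR by lia.
          + split; [apply (le_INR 1)|apply lt_INR]; lia.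
          + apply pos_INR. }
      rewrite Rabs_mult, (Rabs_pos_eq th) by lra. split; nra. }
    assert (G := csum_geom (cis x) N).
    replace (cis x ^ S N)%C with (RtoC 1) in G.
    2:{ rewrite cis_pow. replace (INR (S N) * x)
          with (INR m * (2 * PI) + - (INR n * (2 * PI))) by (unfold x, th; field; lra).
        rewrite cis_plus, <- cis_conj, <- !cis_pow, cis_2PI, !Cpow_1_l.
        unfold Cconj, Cmult, RtoC. simpl. f_equal; ring. }
    assert (Hx' : (1 - cis x)%C <> 0).
    { intros H. apply Hx. replace (cis x) with (1 - (1 - cis x))%C by ring.
      rewrite H. ring. }
    change (fun j => cis x ^ j)%C with (Cpow (cis x)) in G.
    replace (csum (Cpow (cis x)) N)
      with (csum (Cpow (cis x)) N * (1 - cis x) / (1 - cis x))%C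
      by (field; exact Hx').
    rewrite G. field. exact Hx'.
Qed.

Lemma average_const N k : average N (fun _ => k) = k.
Proof.
  pose proof (INR_S_pos N).
  unfold average. rewrite csum_const, RtoC_inv by lra. field.
  intros H0. apply RtoC_inj in H0. lra.
Qed.

(** If the number of sample points exceeds the degree, no two exponents are
    confused modulo [N + 1], so the average isolates a coefficient exactly. With
    [n = 0] and [p > 0] all exponents lie strictly between 0 and [N + 1], and
    nothing survives. *)
Lemma average_psum N a s D p n :
  (D + p <= N)%nat -> (n <= N)%nat ->
  average N (fun z => psum a (s * z) D * (z ^ p * Cconj z ^ n))%C =
  if le_dec p n then if le_dec (n - p) D then (a (n - p)%nat * s ^ (n - p))%C else 0
  else 0.
Proof.
  intros HD Hn. induction D as [|D IH].
  - rewrite (average_ext _ _ (fun z => a O * (z ^ p * Cconj z ^ n))%C)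
      by (intros z _; rewrite psum_0; reflexivity).
    rewrite average_mult_l, average_monomial by lia.
    destruct (Nat.eq_dec p n) as [->|E].
    + rewrite Nat.sub_diag. destruct (le_dec n n); [|lia].
      destruct (le_dec 0 0); [|lia]. reflexivity.
    + destruct (le_dec p n); [|ring]. destruct (le_dec (n - p) 0); [lia|ring].
  - rewrite (average_ext _ _ (fun z => psum a (s * z) D * (z ^ p * Cconj z ^ n)
      + (a (S D) * s ^ S D) * (z ^ (S D + p) * Cconj z ^ n))%C).
    2:{ intros z _. rewrite psum_S, Cpow_mult_l, Cpow_add_r. ring. }
    rewrite average_plus, average_mult_l, IH, average_monomial by lia.
    destruct (Nat.eq_dec (S D + p) n) as [E|E].
    + subst n. destruct (le_dec p (S D + p)); [|lia].
      replace (S D + p - p)%nat with (S D) by lia.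
      destruct (le_dec (S D) D); [lia|]. destruct (le_dec (S D) (S D)); [|lia]. ring.
    + destruct (le_dec p n); [|ring].
      destruct (le_dec (n - p) D); destruct (le_dec (n - p) (S D)); try lia; ring.
Qed.

Lemma average_psum_coefficient N a s D n : (n <= D <= N)%nat ->
  average N (fun z => psum a (s * z) D * Cconj z ^ n)%C = (a n * s ^ n)%C.
Proof.
  intros H. pose proof (average_psum N a s D 0 n ltac:(lia) ltac:(lia)) as E.
  rewrite Nat.sub_0_r in E. destruct (le_dec 0 n); [|lia].
  destruct (le_dec n D); [|lia].
  rewrite <- E. apply average_ext. intros z _. simpl. ring.
Qed.

Lemma average_psum_vanishes N a s D n : (0 < n)%nat -> (D + n <= N)%nat ->
  average N (fun z => psum a (s * z) D * z ^ n)%C = 0.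
Proof.
  intros Hn H. pose proof (average_psum N a s D n 0 ltac:(lia) ltac:(lia)) as E.
  destruct (le_dec n 0); [lia|].
  rewrite <- E. apply average_ext. intros z _. simpl. ring.
Qed.

Lemma Cconj_RtoC (x : R) : Cconj x = x.
Proof. unfold Cconj, RtoC. simpl. rewrite Ropp_0. reflexivity. Qed.

(** * Cauchy's and Caratheodory's inequalities *)

Lemma Cmod_scaled s z : 0 <= s -> Cmod z = 1 -> Cmod (s * z) = s.
Proof.
  intros Hs Hz. rewrite Cmod_mult, Cmod_R, Rabs_pos_eq, Hz by exact Hs. ring.
Qed.

Lemma Re_le_Cmod z : Re z <= Cmod z.
Proof. eapply Rle_trans; [apply Rle_abs|apply re_le_Cmod]. Qed.

(** A coefficient is an average of [f(w) conj(z)^n]: exactly for the partial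
    sums, which approximate [f] uniformly on the circle. *)
Lemma cauchy_circle a rho f s M n :
  power_sum a rho f -> 0 < s < rho -> (forall w, Cmod w = s -> Cmod (f w) <= M) ->
  Cmod (a n) * s ^ n <= M.
Proof.
  intros H Hs HM. apply le_epsilon. intros eps He.
  destruct (power_sum_uniform a rho f s H) with (eps := eps) as [D0 HD]; [lra|lra|].
  set (D := (D0 + n)%nat). specialize (HD D ltac:(unfold D; lia)).
  replace (Cmod (a n) * s ^ n) with (Cmod (a n * s ^ n)).
  2:{ rewrite Cmod_mult, Cmod_pow, Cmod_R, Rabs_pos_eq; lra. }
  rewrite <- (average_psum_coefficient D a s D n) by (unfold D; lia).
  replace (M + eps) with (Re (average D (fun _ => RtoC (M + eps))))
    by (rewrite average_const; reflexivity).
  apply average_le. intros z Hz. simpl Re.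
  assert (Hw : Cmod (s * z) = s) by (apply Cmod_scaled; lra).
  rewrite Cmod_mult, Cmod_pow, Cmod_conj, Hz, pow1.
  specialize (HM _ Hw). specialize (HD (s * z)%C ltac:(lra)).
  pose proof (Cmod_sub_le (psum a (s * z) D) (f (s * z)%C)) as T.
  rewrite (Cmod_minus_sym (psum a _ _)) in T. lra.
Qed.

Lemma cauchy_estimate a rho f M n :
  0 < rho -> power_sum a rho f -> (forall w, Cmod w < rho -> Cmod (f w) <= M) ->
  Cmod (a n) * rho ^ n <= M.
Proof.
  intros Hr H HM. apply pow_le_limit; [exact Hr|]. intros s Hs.
  apply cauchy_circle with rho f; [exact H|exact Hs|].
  intros w Hw. apply HM. lra.
Qed.

(** With [P] a partial sum of [f], averaging [P conj(z)^n] gives [a n s^n],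
    while averaging [conj(P) conj(z)^n] gives 0. Hence [a n s^n] is the average
    of [2 Re(P) conj(z)^n], and equally of [-2 (K - Re P) conj(z)^n] for any
    constant [K], because [conj(z)^n] has average 0 for [n >= 1]. When [K >= Re P] the modulus is at most twice the average of
    [K - Re P], which is [2 (K - Re (a 0))]. *)
Lemma caratheodory_circle a rho f s M n :
  power_sum a rho f -> 0 < s < rho -> (forall w, Cmod w = s -> Re (f w) <= M) ->
  (0 < n)%nat -> Cmod (a n) * s ^ n <= 2 * (M - Re (a O)).
Proof.
  intros H Hs HM Hn. apply le_epsilon. intros eps He.
  destruct (power_sum_uniform a rho f s H) with (eps := eps / 2) as [D0 HD]; [lra|lra|].
  set (D := (D0 + n)%nat). specialize (HD D ltac:(unfold D; lia)).
  (* More points than for Cauchy's estimate: z^n times the partial sum has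
     degree D + n and must still average to 0. *)
  set (N := (D + n)%nat). set (P := fun z => psum a (s * z) D).
  set (K := M + eps / 2).
  assert (E1 : average N (fun z => P z * Cconj z ^ n)%C = (a n * s ^ n)%C).
  { apply average_psum_coefficient. unfold N, D. lia. }
  assert (E2 : average N (fun z => Cconj (P z) * Cconj z ^ n)%C = 0).
  { rewrite (average_ext N _ (fun z => Cconj (P z * z ^ n))%C).
    - rewrite average_conj. unfold P.
      rewrite average_psum_vanishes by (unfold N; lia). apply Cconj_RtoC.
    - intros z _. rewrite Cmult_conj, Cpow_conj. reflexivity. }
  assert (E3 : average N (fun z => Cconj z ^ n)%C = 0).
  { pose proof (average_monomial N 0 n ltac:(unfold N; lia) ltac:(unfold N; lia)) as E.
    destruct (Nat.eq_dec 0 n); [lia|]. rewrite <- E.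
    apply average_ext. intros z _. simpl. ring. }
  assert (E4 : average N P = a O).
  { replace (a O) with (a O * s ^ 0)%C by (simpl; ring).
    rewrite <- (average_psum_coefficient N a s D 0) by (unfold N; lia).
    apply average_ext. intros z _. unfold P. simpl. ring. }
  replace (Cmod (a n) * s ^ n) with (Cmod (a n * s ^ n)).
  2:{ rewrite Cmod_mult, Cmod_pow, Cmod_R, Rabs_pos_eq; lra. }
  replace (a n * s ^ n)%C with
    (average N (fun z => (-2) * ((K - Re (P z)) * Cconj z ^ n))%C).
  2:{ rewrite <- E1.
      rewrite (average_ext N _ (fun z => (P z * Cconj z ^ n + Cconj (P z) * Cconj z ^ n)
        + (-2 * K) * Cconj z ^ n)%C).
      - rewrite !average_plus, average_mult_l, E2, E3. ring.
      - intros z _. rewrite re_alt. field. }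
  rewrite average_mult_l, Cmod_mult, Cmod_R.
  replace (Rabs (-2)) with 2 by (rewrite Rabs_left; lra).
  replace (2 * (M - Re (a O)) + eps) with (2 * (K - Re (a O))) by (unfold K; field).
  apply Rmult_le_compat_l; [lra|].
  replace (K - Re (a O)) with (Re (average N (fun z => K + (-1) * P z)%C)).
  2:{ rewrite average_plus, average_const, average_mult_l, E4, re_plus, re_scal_l, re_RtoC.
      ring. }
  apply average_le. intros z Hz.
  assert (Hw : Cmod (s * z) = s) by (apply Cmod_scaled; lra).
  specialize (HM _ Hw). specialize (HD (s * z)%C ltac:(lra)).
  pose proof (Re_le_Cmod (P z - f (s * z)%C)) as T. unfold Cminus in T.
  rewrite re_plus, re_opp in T.
  change (P z + - f (s * z))%C with (P z - f (s * z))%C in T.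
  rewrite Cmod_minus_sym in T. unfold P at 2 in T.
  rewrite re_plus, re_scal_l, re_RtoC.
  rewrite Cmod_mult, Cmod_pow, Cmod_conj, Hz, pow1, Rmult_1_r.
  rewrite <- RtoC_minus, Cmod_R, Rabs_pos_eq; unfold K; lra.
Qed.

(** * Operations on power series and uniqueness *)

Lemma power_sum_ext a b rho f g :
  (forall n, a n = b n) -> (forall w, Cmod w < rho -> f w = g w) ->
  power_sum a rho f -> power_sum b rho g.
Proof.
  intros Ea Ef H w Hw. rewrite <- Ef by exact Hw.
  apply tends_ext with (2 := H w Hw). intros N. apply csum_ext.
  intros n. rewrite Ea. reflexivity.
Qed.

Lemma power_sum_mono a r1 r2 f : r2 <= r1 -> power_sum a r1 f -> power_sum a r2 f.
Proof. intros Hr H w Hw. apply H. lra. Qed.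

Lemma power_sum_plus a b rho f g :
  power_sum a rho f -> power_sum b rho g ->
  power_sum (fun n => a n + b n)%C rho (fun w => f w + g w)%C.
Proof.
  intros Ha Hb w Hw.
  apply tends_ext with (2 := tends_plus _ _ _ _ (Ha w Hw) (Hb w Hw)).
  intros N. unfold psum. rewrite <- csum_plus. apply csum_ext. intros n. ring.
Qed.

Lemma power_sum_mult_l k a rho f :
  power_sum a rho f -> power_sum (fun n => k * a n)%C rho (fun w => k * f w)%C.
Proof.
  intros Ha w Hw.
  apply tends_ext with (2 := tends_mult_l k _ _ (Ha w Hw)).
  intros N. unfold psum. rewrite <- csum_mult_l. apply csum_ext. intros n. ring.
Qed.

Definition shift (a : nat -> C) (n : nat) : C :=
  match n with O => RtoC 0 | S m => a m end.

Lemma psum_shift a w N : psum (shift a) w (S N) = (w * psum a w N)%C.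
Proof.
  induction N as [|N IH].
  - rewrite psum_S, !psum_0. simpl. ring.
  - rewrite psum_S, IH, psum_S. simpl. ring.
Qed.

Lemma power_sum_shift a rho f :
  power_sum a rho f -> power_sum (shift a) rho (fun w => w * f w)%C.
Proof.
  intros Ha w Hw. apply (tends_shift_index _ _ 1).
  apply tends_ext with (2 := tends_mult_l w _ _ (Ha w Hw)).
  intros N. rewrite Nat.add_1_r, psum_shift. reflexivity.
Qed.

Definition constant_coeff (k : C) (n : nat) : C :=
  match n with O => k | S _ => RtoC 0 end.

Lemma power_sum_const k rho : power_sum (constant_coeff k) rho (fun _ => k).
Proof.
  intros w _. apply tends_ext with (2 := tends_const k). intros N.
  induction N as [|N IH].
  - rewrite psum_0. reflexivity.
  - rewrite psum_S, <- IH. simpl. ring.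
Qed.

Lemma power_sum_at_0 a rho f : 0 < rho -> power_sum a rho f -> f 0 = a O.
Proof.
  intros Hr H. apply tends_unique with (psum a 0).
  - apply H. rewrite Cmod_0. exact Hr.
  - apply tends_ext with (2 := tends_const (a O)). intros N.
    induction N as [|N IH].
    + rewrite psum_0. reflexivity.
    + rewrite psum_S, <- IH. simpl. ring.
Qed.

(** Cauchy's estimate applied to the difference, which sums to 0. *)
Lemma power_sum_unique a b rho f :
  0 < rho -> power_sum a rho f -> power_sum b rho f -> forall n, a n = b n.
Proof.
  intros Hr Ha Hb n.
  assert (H := power_sum_plus _ _ _ _ _ Ha (power_sum_mult_l (-1) _ _ _ Hb)).
  assert (E := cauchy_circle _ _ _ (rho / 2) 0 n H ltac:(lra)).
  assert (Hp : 0 < (rho / 2) ^ n) by (apply pow_lt; lra).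
  assert (E0 : (a n + -1 * b n)%C = 0).
  { apply Cmod_eq_0. pose proof (Cmod_ge_0 (a n + -1 * b n)).
    assert (Cmod (a n + -1 * b n) * (rho / 2) ^ n <= 0); [|nra].
    apply E. intros w _. replace (f w + -1 * f w)%C with (RtoC 0) by ring.
    rewrite Cmod_0. lra. }
  replace (a n) with (a n + -1 * b n + b n)%C by ring. rewrite E0. ring.
Qed.

(** * Locally uniform limits *)

Definition locally_uniform (S : nat -> C -> C) (rho : R) (g : C -> C) : Prop :=
  forall s eps, 0 < s < rho -> 0 < eps ->
    eventually (fun K => forall w, Cmod w <= s -> Cmod (g w - S K w) <= eps).

(** Cauchy's estimate turns uniform smallness of [S K - S L] on a circle of
    radius [s] into [|e K n - e L n| s^n] small uniformly in [n], so the
    coefficients converge, and fast enough for the limit coefficients to sum to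
    the limit function. This single lemma replaces all rearrangements of double
    series: products, compositions and changes of centre are limits of finite
    sums. *)
Lemma weierstrass e S rho g :
  0 < rho -> (forall K, power_sum (e K) rho (S K)) -> locally_uniform S rho g ->
  exists b, (forall n, tends (fun K => e K n) (b n)) /\ power_sum b rho g.
Proof.
  intros Hr He HS.
  assert (D : forall s eps, 0 < s < rho -> 0 < eps ->
    exists K0, forall K L, (K0 <= K)%nat -> (K0 <= L)%nat ->
      forall n, Cmod (e K n - e L n) * s ^ n <= eps).
  { intros s eps Hs Heps. destruct (HS s (eps / 2) Hs) as [K0 HK]; [lra|].
    exists K0. intros K L HK1 HL1 n.
    assert (H := power_sum_plus _ _ _ _ _ (He K) (power_sum_mult_l (-1) _ _ _ (He L))).
    replace (e K n - e L n)%C with (e K n + -1 * e L n)%C by ring.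
    apply (cauchy_circle _ _ _ s eps n H Hs).
    intros w Hw. pose proof (HK K HK1 w ltac:(lra)) as T1.
    pose proof (HK L HL1 w ltac:(lra)) as T2. rewrite Cmod_minus_sym in T1.
    replace (S K w + -1 * S L w)%C with ((S K w - g w) + (g w - S L w))%C by ring.
    eapply Rle_trans; [apply Cmod_triangle|lra]. }
  assert (L : forall n, exists l, tends (fun K => e K n) l).
  { intros n. apply tends_cauchy. intros eps Heps.
    assert (Hp : 0 < (rho / 2) ^ n) by (apply pow_lt; lra).
    destruct (D (rho / 2) (eps * (rho / 2) ^ n)) as [K0 HK]; [lra|nra|].
    exists K0. intros K L HK1 HL1.
    apply Rmult_le_reg_r with ((rho / 2) ^ n); [exact Hp|]. auto. }
  set (b := fun n => proj1_sig (constructive_indefinite_description _ (L n))).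
  assert (Hb : forall n, tends (fun K => e K n) (b n)).
  { intros n. exact (proj2_sig (constructive_indefinite_description _ (L n))). }
  exists b. split; [exact Hb|].
  intros w Hw eps Heps. pose proof (Cmod_ge_0 w).
  set (s := (Cmod w + rho) / 2).
  assert (Hs : 0 < s < rho) by (unfold s; lra).
  destruct (ratio_bounds (Cmod w) s) as [Hq Hwq]; [unfold s; lra|].
  set (q := Cmod w / s) in *.
  (* The difference of the two partial sums is at most eta / (1 - q) = eps / 4. *)
  set (eta := eps / 4 * (1 - q)).
  assert (Heta : 0 < eta) by (unfold eta; apply Rmult_lt_0_compat; lra).
  assert (Heta' : eta <= eps / 4) by (unfold eta; nra).
  destruct (D s eta Hs Heta) as [K0 HK].
  destruct (HS s eta Hs Heta) as [K1 HK1].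
  set (K := (K0 + K1)%nat).
  assert (Hbe : forall n, Cmod (b n - e K n) * s ^ n <= eta).
  { intros n. rewrite Cmod_minus_sym.
    assert (Hp : 0 < s ^ n) by (apply pow_lt; lra).
    apply Rle_div_r; [exact Hp|].
    apply tends_le with (fun L => e K n + -1 * e L n)%C.
    - replace (e K n - b n)%C with (e K n + -1 * b n)%C by ring.
      apply tends_plus; [apply tends_const|apply tends_mult_l, Hb].
    - exists K0. intros L0 HL. apply Rle_div_r; [exact Hp|].
      replace (e K n + -1 * e L0 n)%C with (e K n - e L0 n)%C by ring.
      apply HK; [unfold K; lia|exact HL]. }
  pose proof (psum_bound _ _ q s w (proj1 Hs) Hq Hwq Hbe) as T1.
  specialize (HK1 K ltac:(unfold K; lia) w ltac:(unfold s; lra)).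
  apply filter_imp with (2 := He K w Hw (eps / 4) ltac:(lra)).
  intros J HJ. specialize (T1 J).
  replace (eta / (1 - q)) with (eps / 4) in T1 by (unfold eta; field; lra).
  assert (E : psum b w J = (psum (fun n => b n - e K n)%C w J + psum (e K) w J)%C).
  { unfold psum. rewrite <- csum_plus. apply csum_ext. intros n. ring. }
  replace (psum b w J - g w)%C with (psum (fun n => b n - e K n)%C w J
    + ((psum (e K) w J - S K w) + (S K w - g w)))%C by (rewrite E; ring).
  eapply Rle_lt_trans; [apply Cmod_triangle|].
  pose proof (Cmod_triangle (psum (e K) w J - S K w) (S K w - g w)) as T2.
  rewrite (Cmod_minus_sym (S K w)) in T2. lra.
Qed.

Definition expandable (rho : R) (f : C -> C) : Prop := exists a, power_sum a rho f.

Lemma expandable_limit S rho g :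
  0 < rho -> (forall K, expandable rho (S K)) -> locally_uniform S rho g ->
  expandable rho g.
Proof.
  intros Hr HS Hg.
  destruct (weierstrass (fun K => proj1_sig (constructive_indefinite_description _ (HS K)))
    S rho g Hr) as [b [_ Hb]]; [|exact Hg|exists b; exact Hb].
  intros K. exact (proj2_sig (constructive_indefinite_description _ (HS K))).
Qed.

Lemma expandable_csum rho (F : nat -> C -> C) N :
  (forall n, expandable rho (F n)) -> expandable rho (fun w => csum (fun n => F n w) N).
Proof.
  intros H. induction N as [|N [a Ha]].
  - destruct (H O) as [a Ha]. exists a. apply power_sum_ext with (3 := Ha); auto.
    intros w _. rewrite csum_0. reflexivity.
  - destruct (H (S N)) as [b Hb]. eexists.
    apply power_sum_ext with (3 := power_sum_plus _ _ _ _ _ Ha Hb); [reflexivity|].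
    intros w _. rewrite csum_S. reflexivity.
Qed.

Lemma expandable_mult_l k rho f : expandable rho f -> expandable rho (fun w => k * f w)%C.
Proof. intros [a Ha]. eexists. apply power_sum_mult_l, Ha. Qed.

Lemma expandable_mult_monomial rho f n :
  expandable rho f -> expandable rho (fun w => w ^ n * f w)%C.
Proof.
  intros H. induction n as [|n [a Ha]].
  - destruct H as [a Ha]. exists a. apply power_sum_ext with (3 := Ha); auto.
    intros w _. simpl. ring.
  - eexists. apply power_sum_ext with (3 := power_sum_shift _ _ _ Ha); [reflexivity|].
    intros w _. simpl. ring.
Qed.

Lemma expandable_bounded rho f s :
  expandable rho f -> 0 < s < rho -> exists B, forall w, Cmod w <= s -> Cmod (f w) <= B.
Proof.
  intros [a Ha] Hs. set (t := (s + rho) / 2).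
  destruct (power_sum_terms_bounded a rho f t Ha) as [B HB]; [unfold t; lra|].
  destruct (ratio_bounds s t) as [Hq Hst]; [unfold t; lra|].
  exists (B / (1 - s / t)). intros w Hw.
  apply tends_le with (psum a w); [apply Ha; lra|].
  apply filter_forall. apply psum_bound with t; try assumption; [unfold t|]; lra.
Qed.

(** Limit of [f] times the partial sums of [g]. *)
Lemma expandable_mult rho f g :
  0 < rho -> expandable rho f -> expandable rho g -> expandable rho (fun w => f w * g w)%C.
Proof.
  intros Hr Hf [b Hb].
  apply expandable_limit with (S := fun K w => (f w * psum b w K)%C); [exact Hr| |].
  - intros K.
    destruct (expandable_csum rho (fun n w => b n * (w ^ n * f w))%C K) as [a Ha].
    { intros n. apply expandable_mult_l, expandable_mult_monomial, Hf. }
    exists a. apply power_sum_ext with (3 := Ha); auto.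
    intros w _. unfold psum. rewrite <- csum_mult_l. apply csum_ext. intros n. ring.
  - intros s eps Hs He.
    destruct (expandable_bounded rho f s Hf Hs) as [B HB].
    assert (HB1 : 0 < Rabs B + 1) by (pose proof (Rabs_pos B); lra).
    apply filter_imp with (2 := power_sum_uniform b rho g s Hb ltac:(lra)
      (eps / (Rabs B + 1)) ltac:(apply Rdiv_lt_0_compat; lra)).
    intros K HK w Hw. specialize (HK w Hw). specialize (HB w Hw).
    replace (f w * g w - f w * psum b w K)%C with (f w * (g w - psum b w K))%C by ring.
    rewrite Cmod_mult. apply Rlt_div_r in HK; [|exact HB1].
    pose proof (Rle_abs B). pose proof (Cmod_ge_0 (g w - psum b w K)).
    pose proof (Cmod_ge_0 (f w)). nra.
Qed.

Lemma expandable_pow rho f n :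
  0 < rho -> expandable rho f -> expandable rho (fun w => f w ^ n)%C.
Proof.
  intros Hr Hf. induction n as [|n IH].
  - exists (constant_coeff 1). exact (power_sum_const 1 rho).
  - apply (expandable_mult rho f (fun w => f w ^ n)%C Hr Hf IH).
Qed.

(** * Schwarz's lemma and composition *)

Lemma bounded_powers x K : 0 <= x -> (forall k, x ^ k <= K) -> x <= 1.
Proof.
  intros Hx H. destruct (Rle_dec x 1) as [L|L]; [exact L|exfalso].
  destruct (INR_unbounded (K / (x - 1))) as [n Hn].
  apply Rlt_div_l in Hn; [|lra].
  pose proof (Rle_pow_lin (x - 1) n ltac:(lra)) as P.
  replace (1 + (x - 1)) with x in P by ring. specialize (H n). lra.
Qed.

(** Write [f(z) = z g(z)]. On [|z| = s] one has [|g ^ k| <= s ^ (-k)], so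
    Cauchy's estimate and [s -> 1] bound every coefficient of [g ^ k] by 1. At a
    fixed [w] this gives [|g w| ^ k <= 1 / (1 - |w|)] for all [k], whence
    [|g w| <= 1]: taking powers stands in for the maximum principle. *)
Lemma schwarz_lemma f :
  expandable 1 f -> f 0 = 0 -> (forall w, Cmod w < 1 -> Cmod (f w) <= 1) ->
  forall w, Cmod w < 1 -> Cmod (f w) <= Cmod w.
Proof.
  intros [a Ha] H0 Hf w Hw.
  assert (Ha0 : a O = 0) by (rewrite <- (power_sum_at_0 a 1 f); [exact H0|lra|exact Ha]).
  destruct (power_sum_of_bounds (fun n => a (S n)) 1) as [g Hg].
  { intros t Ht. destruct (power_sum_terms_bounded a 1 f t Ha) as [B HB]; [lra|].
    exists (B / t). intros n. apply (Rle_div_r _ B t (proj1 Ht)).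
    eapply Rle_trans; [right|exact (HB (S n))]. simpl. ring. }
  assert (Efg : forall z, Cmod z < 1 -> f z = (z * g z)%C).
  { intros z Hz. apply tends_unique with (psum a z); [apply Ha, Hz|].
    refine (power_sum_ext _ a _ _ _ _ _ (power_sum_shift _ _ _ Hg) z Hz); [|reflexivity].
    intros [|n]; [symmetry; exact Ha0|reflexivity]. }
  assert (Hg1 : Cmod (g w) <= 1).
  { apply bounded_powers with (1 / (1 - Cmod w)); [apply Cmod_ge_0|]. intros k.
    destruct (expandable_pow 1 g k) as [c Hc]; [lra|eexists; exact Hg|].
    assert (Hc1 : forall n, Cmod (c n) <= 1).
    { intros n. replace (Cmod (c n)) with (Cmod (c n) * 1 ^ (n + k))
        by (rewrite pow1; ring).
      apply pow_le_limit; [lra|]. intros s Hs.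
      assert (Hsk : 0 < s ^ k) by (apply pow_lt; lra).
      rewrite pow_add, <- Rmult_assoc. apply Rle_div_r; [exact Hsk|].
      apply cauchy_circle with 1 (fun z => g z ^ k)%C; [exact Hc|lra|].
      intros z Hz. apply Rle_div_r; [exact Hsk|].
      rewrite <- Hz at 1. rewrite <- Cmod_pow, <- Cmod_mult, <- Cpow_mult_l, Cmult_comm.
      rewrite Cmult_comm, (Cmult_comm (g z)), <- Efg, Cmod_pow by lra.
      rewrite <- (pow1 k). apply pow_incr. split; [apply Cmod_ge_0|]. apply Hf. lra. }
    rewrite <- Cmod_pow.
    apply tends_le with (psum c w); [apply Hc, Hw|]. apply filter_forall.
    apply psum_bound with 1; try lra.
    - split; [apply Cmod_ge_0|exact Hw].
    - intros n. rewrite pow1, Rmult_1_r. apply Hc1. }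
  rewrite Efg, Cmod_mult by exact Hw. pose proof (Cmod_ge_0 w). nra.
Qed.

(** By Schwarz's lemma [phi] maps [|w| <= s] into itself, where the series of [h]
    converges uniformly; so [h o phi] is the locally uniform limit of polynomials
    in [phi]. *)
Lemma expandable_comp_schwarz h phi :
  expandable 1 h -> expandable 1 phi -> phi 0 = 0 ->
  (forall w, Cmod w < 1 -> Cmod (phi w) <= 1) ->
  expandable 1 (fun w => h (phi w)).
Proof.
  intros [b Hb] Hphi H0 H1.
  apply expandable_limit with (S := fun K w => psum b (phi w) K); [lra| |].
  - intros K. apply (expandable_csum 1 (fun n w => b n * phi w ^ n)%C).
    intros n. apply expandable_mult_l, expandable_pow; [lra|exact Hphi].
  - intros s eps Hs He.
    apply filter_imp with (2 := power_sum_uniform b 1 h s Hb ltac:(lra) eps He).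
    intros K HK w Hw. left. apply HK.
    eapply Rle_trans; [apply schwarz_lemma; auto; lra|exact Hw].
Qed.

(** * Bohr's inequality for bounded power series *)

(** Rotating so that [a 0 >= 0], Caratheodory's inequality gives
    [|a n| <= 2 (M - |a 0|)] for [n >= 1]. The constant 1/3 is where
    [2 (r + r^2 + ...) = 1], so that the sum is at most
    [|a 0| + (M - |a 0|) = M]. *)
Lemma coefficient_sum_le a g M r N :
  power_sum a 1 g -> (forall w, Cmod w < 1 -> Cmod (g w) <= M) -> 0 <= r <= 1 / 3 ->
  sum_n (fun n => Cmod (a n) * r ^ n) N <= M.
Proof.
  intros Ha HM Hr.
  assert (Hrot : exists u, Cmod u = 1 /\ (u * a O)%C = Cmod (a O)).
  { destruct (Ceq_dec (a O) 0) as [E|E].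
    - exists 1. split; [apply Cmod_1|]. rewrite E, Cmod_0. ring.
    - assert (Hm : Cmod (a O) <> 0) by (intros H; apply E, Cmod_eq_0, H).
      assert (HmC : RtoC (Cmod (a O)) <> 0) by (intros H; apply Hm, RtoC_inj, H).
      exists (Cconj (a O) / Cmod (a O))%C. split.
      + rewrite Cmod_div, Cmod_conj, Cmod_R, Rabs_pos_eq by (exact HmC || apply Cmod_ge_0).
        field. exact Hm.
      + replace (Cconj (a O) / Cmod (a O) * a O)%C
          with (a O * Cconj (a O) / Cmod (a O))%C by (field; exact HmC).
        rewrite <- Cmod2_conj, RtoC_pow. field. exact HmC. }
  destruct Hrot as [u [Hu Hu0]].
  assert (Hn : forall n, (0 < n)%nat -> Cmod (a n) <= 2 * (M - Cmod (a O))).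
  { intros n Hn. replace (Cmod (a n)) with (Cmod (u * a n) * 1 ^ n)
      by (rewrite Cmod_mult, Hu, pow1; ring).
    apply pow_le_limit; [lra|]. intros s Hs.
    replace (Cmod (a O)) with (Re (u * a O)) by (rewrite Hu0; reflexivity).
    apply (caratheodory_circle _ _ _ s M n (power_sum_mult_l u _ _ _ Ha) Hs); [|exact Hn].
    intros w Hw. eapply Rle_trans; [apply Re_le_Cmod|].
    rewrite Cmod_mult, Hu, Rmult_1_l. apply HM. lra. }
  assert (H0 : Cmod (a O) <= M).
  { rewrite <- (power_sum_at_0 a 1 g); [|lra|exact Ha]. apply HM. rewrite Cmod_0. lra. }
  (* This is |a 0| + 2 (M - |a 0|) (1/3 + 1/9 + ... + (1/3)^N), summed. *)
  apply Rle_trans with (M - (M - Cmod (a O)) * (1 / 3) ^ N).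
  2:{ assert (0 <= (1 / 3) ^ N) by (apply pow_le; lra). nra. }
  induction N as [|N IH].
  - rewrite sum_O. simpl. lra.
  - rewrite sum_Sn. change plus with Rplus. specialize (Hn (S N) ltac:(lia)).
    assert (Hp : r ^ S N <= (1 / 3) ^ S N) by (apply pow_incr; lra).
    assert (Hp0 : 0 <= r ^ S N) by (apply pow_le; lra).
    pose proof (Cmod_ge_0 (a (S N))).
    assert (Cmod (a (S N)) * r ^ S N <= 2 * (M - Cmod (a O)) * (1 / 3) ^ S N)
      by (apply Rmult_le_compat; assumption).
    replace ((1 / 3) ^ N) with (3 * (1 / 3) ^ S N) in IH by (simpl; field). lra.
Qed.

(** * Change of centre *)

(** The Taylor coefficients of [u |-> (c + u) ^ n], generated by multiplying by
    [c + u]; unlike a closed form they vanish for [k > n] without a case split. *)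
Fixpoint translated_power (c : C) (n : nat) : nat -> C :=
  match n with
  | O => constant_coeff 1
  | S m => fun k => (c * translated_power c m k + shift (translated_power c m) k)%C
  end.

Lemma power_sum_translated_power c rho n :
  power_sum (translated_power c n) rho (fun u => (c + u) ^ n)%C.
Proof.
  induction n as [|n IH].
  - exact (power_sum_const 1 rho).
  - apply power_sum_ext with
      (3 := power_sum_plus _ _ _ _ _ (power_sum_mult_l c _ _ _ IH) (power_sum_shift _ _ _ IH)).
    + reflexivity.
    + intros w _. simpl. ring.
Qed.

Lemma translated_power_above c n k : (n < k)%nat -> translated_power c n k = 0.
Proof.
  revert k. induction n as [|n IH]; intros [|k] Hk; try lia.
  - reflexivity.
  - simpl. rewrite !IH by lia. ring.
Qed.

Lemma translated_power_eq c k n :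
  translated_power c (n + k) k = (Binomial.C (n + k) k * c ^ n)%C.
Proof.
  revert k. induction n as [|n IHn]; intros k.
  - simpl Nat.add. rewrite C_n_n. induction k as [|k IHk].
    + simpl. ring.
    + simpl. rewrite IHk, translated_power_above by lia. simpl. ring.
  - induction k as [|k IHk].
    + specialize (IHn O). rewrite C_n_0 in *. rewrite Nat.add_0_r in *.
      simpl. rewrite IHn. ring.
    + replace (S n + S k)%nat with (S (n + S k)) by lia.
      rewrite <- pascal by lia. rewrite RtoC_plus. simpl. rewrite IHn.
      replace (n + S k)%nat with (S n + k)%nat by lia. rewrite IHk. simpl. ring.
Qed.

Lemma csum_zero (u : nat -> C) N : (forall n, (n <= N)%nat -> u n = 0) -> csum u N = 0.
Proof.
  induction N as [|N IH]; intros H.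
  - rewrite csum_0. auto.
  - rewrite csum_S, IH, H by auto. ring.
Qed.

(** The Taylor coefficient of order [k] at [c] is itself a power series in [c].
    This form is what allows Cauchy's estimate to be applied a second time, in
    the variable [c]. *)
Lemma power_sum_translate a rho f c :
  power_sum a rho f -> Cmod c < rho ->
  exists e, power_sum e (rho - Cmod c) (fun u => f (c + u)%C) /\
    forall k, tends (psum (fun n => Binomial.C (n + k) k * a (n + k)%nat)%C c) (e k).
Proof.
  intros Ha Hc. pose proof (Cmod_ge_0 c).
  destruct (weierstrass
    (fun K k => csum (fun n => a n * translated_power c n k)%C K)
    (fun K u => psum a (c + u) K) (rho - Cmod c) (fun u => f (c + u)%C))
    as [e [He1 He2]].
  - lra.
  - induction K as [|K IH].
    + apply power_sum_ext with
        (3 := power_sum_mult_l (a O) _ _ _ (power_sum_translated_power c _ 0)).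
      * intros n. rewrite csum_0. reflexivity.
      * intros w _. rewrite psum_0. simpl. ring.
    + apply power_sum_ext with (3 := power_sum_plus _ _ _ _ _ IH
        (power_sum_mult_l (a (S K)) _ _ _ (power_sum_translated_power c _ (S K)))).
      * intros n. rewrite csum_S. reflexivity.
      * intros w _. rewrite psum_S. reflexivity.
  - intros s eps Hs Heps.
    apply filter_imp with
      (2 := power_sum_uniform a rho f (Cmod c + s) Ha ltac:(lra) eps Heps).
    intros K HK w Hw. left. apply HK.
    eapply Rle_trans; [apply Cmod_triangle|lra].
  - exists e. split; [exact He2|]. intros k.
    apply tends_ext with (2 := proj2 (tends_shift_index _ _ k) (He1 k)).
    intros N. simpl. induction N as [|N IH].
    + rewrite psum_0. simpl Nat.add. destruct k as [|k].
      * rewrite csum_0, C_n_0. simpl. ring.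
      * rewrite csum_S, csum_zero.
        2:{ intros n Hn. rewrite translated_power_above by lia. ring. }
        pose proof (translated_power_eq c (S k) 0) as E. simpl (0 + S k)%nat in *.
        rewrite E. simpl (c ^ 0)%C. ring.
    + change (S N + k)%nat with (S (N + k)). rewrite csum_S, IH, psum_S.
      change (S (N + k)) with (S N + k)%nat. rewrite translated_power_eq. ring.
Qed.

(** * From local expansions to the whole disc *)

Lemma linear_times_geometric_bounded x : 0 < x < 1 ->
  exists B, forall n, INR (S n) * x ^ n <= B.
Proof.
  intros Hx.
  (* Bernoulli's inequality: x^(-n) = (1 + h)^n >= 1 + n h. *)
  set (h := / x - 1).
  assert (Hh : 0 < h).
  { unfold h. assert (1 < / x) by (rewrite <- Rinv_1; apply Rinv_lt_contravar; lra). lra. }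
  exists (1 + / h). intros n.
  pose proof (Rle_pow_lin h n ltac:(lra)) as P.
  replace (1 + h) with (/ x) in P by (unfold h; ring). rewrite pow_inv in P.
  assert (Hp : 0 < x ^ n) by (apply pow_lt; lra).
  assert (P1 : (1 + INR n * h) * x ^ n <= 1).
  { apply Rmult_le_compat_r with (r := x ^ n) in P; [|lra].
    rewrite Rinv_l in P by lra. exact P. }
  assert (Hi : 0 < / h) by (apply Rinv_0_lt_compat; exact Hh).
  assert (P2 : INR n * x ^ n <= / h).
  { replace (INR n * x ^ n) with (/ h * (INR n * h * x ^ n)) by (field; lra).
    rewrite <- (Rmult_1_r (/ h)) at 2. apply Rmult_le_compat_l; [lra|]. nra. }
  assert (P3 : x ^ n <= 1) by (rewrite <- (pow1 n); apply pow_incr; lra).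
  rewrite S_INR. lra.
Qed.

(** Fix [k]. At each [c] the Taylor coefficient of order [k] of [f] is at most
    [M / d^k] by Cauchy's estimate in the disc of radius [d] about [c]. As a
    function of [c] it is the power series with coefficients
    [binom (m+k) k * a (m+k)] on [|c| < rho], so a second Cauchy estimate gives
    [|a (m+k)| binom (m+k) k rho^m d^k <= M]. Summing over [m + k = n] produces
    the binomial expansion of [(rho + d)^n]. *)
Lemma extended_coefficients_bounded a rho f d M n :
  0 < rho -> 0 < d -> power_sum a rho f ->
  (forall c, Cmod c < rho -> exists b, power_sum b d (fun u => f (c + u)%C)) ->
  (forall c u, Cmod c < rho -> Cmod u < d -> Cmod (f (c + u)%C) <= M) ->
  Cmod (a n) * (rho + d) ^ n <= INR (S n) * M.
Proof.
  intros Hr Hd Ha Hloc HM.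
  assert (T : forall m k,
    Cmod (a (m + k)%nat) * (Binomial.C (m + k) k * d ^ k * rho ^ m) <= M).
  { intros m k. assert (Hdk : 0 < d ^ k) by (apply pow_lt; exact Hd).
    assert (HC : 0 <= Binomial.C (m + k) k).
    { unfold Binomial.C. left. apply Rdiv_lt_0_compat.
      - apply INR_fact_lt_0.
      - apply Rmult_lt_0_compat; apply INR_fact_lt_0. }
    set (b := fun m => (Binomial.C (m + k) k * a (m + k)%nat)%C).
    assert (E : forall c, exists l, Cmod c < rho -> tends (psum b c) l /\ Cmod l * d ^ k <= M).
    { intros c. destruct (Rlt_dec (Cmod c) rho) as [Hc|Hc].
      2:{ exists (RtoC 0). intros. contradiction. }
      destruct (power_sum_translate a rho f c Ha Hc) as [e [He1 He2]].
      exists (e k). intros _. split; [apply He2|].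
      destruct (Hloc c Hc) as [g Hg].
      assert (Hmin : 0 < Rmin d (rho - Cmod c)) by (apply Rmin_glb_lt; lra).
      rewrite (power_sum_unique e g _ (fun u => f (c + u)%C) Hmin).
      - apply cauchy_estimate with (fun u => f (c + u)%C); auto.
      - apply power_sum_mono with (2 := He1). apply Rmin_r.
      - apply power_sum_mono with (2 := Hg). apply Rmin_l. }
    set (F := fun c => proj1_sig (constructive_indefinite_description _ (E c))).
    assert (HF : forall c, Cmod c < rho -> tends (psum b c) (F c) /\ Cmod (F c) * d ^ k <= M).
    { intros c. exact (proj2_sig (constructive_indefinite_description _ (E c))). }
    assert (Hb : power_sum b rho F) by (intros c Hc; apply HF, Hc).
    pose proof (cauchy_estimate b rho F (M / d ^ k) m Hr Hb) as Q.
    apply Rle_trans with (Cmod (b m) * rho ^ m * d ^ k).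
    - unfold b. rewrite Cmod_mult, Cmod_R, (Rabs_pos_eq _ HC). right. ring.
    - apply (Rle_div_r _ M _ Hdk). apply Q. intros w Hw.
      apply (Rle_div_r _ M _ Hdk). apply HF, Hw. }
  rewrite Rplus_comm, binomial, scal_sum, (Rmult_comm _ M), <- sum_cte.
  apply sum_Rle. intros k Hk. specialize (T (n - k)%nat k).
  replace (n - k + k)%nat with n in T by lia. lra.
Qed.

(** The coefficient bound makes the series converge to some [g] on the larger
    disc. A point [w] there is compared with the centre
    [c = (rho / (rho + d)) w]: [f] and [g] have Taylor series at [c] which agree
    because [f = g] near [c], and [w] lies within [d] of [c]. *)
Lemma power_sum_extend a rho f d M :
  0 < rho -> 0 < d -> power_sum a rho f ->
  (forall c, Cmod c < rho -> exists b, power_sum b d (fun u => f (c + u)%C)) ->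
  (forall c u, Cmod c < rho -> Cmod u < d -> Cmod (f (c + u)%C) <= M) ->
  power_sum a (rho + d) f.
Proof.
  intros Hr Hd Ha Hloc HM.
  destruct (power_sum_of_bounds a (rho + d)) as [g Hg].
  { intros t Ht.
    destruct (ratio_bounds t (rho + d)) as [Hx Hxt]; [lra|].
    set (x := t / (rho + d)) in *.
    assert (Hx0 : 0 < x) by (unfold x; apply Rdiv_lt_0_compat; lra).
    destruct (linear_times_geometric_bounded x) as [B HB]; [lra|].
    assert (HM0 : 0 <= M).
    { eapply Rle_trans; [|apply (HM 0 0); rewrite Cmod_0; assumption]. apply Cmod_ge_0. }
    exists (M * B). intros n.
    pose proof (extended_coefficients_bounded a rho f d M n Hr Hd Ha Hloc HM) as T.
    assert (Hp : 0 < x ^ n) by (apply pow_lt; exact Hx0).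
    replace (t ^ n) with (x ^ n * (rho + d) ^ n).
    2:{ rewrite <- Rpow_mult_distr. f_equal. unfold x. field. lra. }
    specialize (HB n).
    apply Rle_trans with (INR (S n) * M * x ^ n); [nra|].
    apply Rmult_le_compat_l with (r := M) in HB; [lra|exact HM0]. }
  assert (Hfg : forall w, Cmod w < rho -> g w = f w).
  { intros w Hw. apply tends_unique with (psum a w); [apply Hg; lra|apply Ha, Hw]. }
  intros w Hw. replace (f w) with (g w); [apply Hg, Hw|].
  set (t := rho / (rho + d)).
  assert (Ht : 0 < t) by (unfold t; apply Rdiv_lt_0_compat; lra).
  assert (Ht1 : t * (rho + d) = rho) by (unfold t; field; lra).
  assert (Ht2 : t < 1) by nra.
  set (c := (t * w)%C). set (u := ((1 - t)%R * w)%C).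
  assert (Ew : w = (c + u)%C) by (unfold c, u; rewrite RtoC_minus; ring).
  pose proof (Cmod_ge_0 w).
  assert (Hc : Cmod c < rho).
  { unfold c. rewrite Cmod_mult, Cmod_R, Rabs_pos_eq by lra. nra. }
  assert (Hu : Cmod u < d).
  { unfold u. rewrite Cmod_mult, Cmod_R, Rabs_pos_eq by lra. nra. }
  destruct (Hloc c Hc) as [b Hb].
  destruct (power_sum_translate a (rho + d) g c Hg) as [e [He _]]; [lra|].
  assert (Ebe : forall n, b n = e n).
  { apply (power_sum_unique b e (Rmin d (rho - Cmod c)) (fun u => f (c + u)%C)).
    - apply Rmin_glb_lt; lra.
    - apply power_sum_mono with (2 := Hb). apply Rmin_l.
    - apply power_sum_ext with e (fun u => g (c + u)%C); [reflexivity| |].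
      + intros z Hz. apply Hfg. eapply Rle_lt_trans; [apply Cmod_triangle|].
        pose proof (Rmin_r d (rho - Cmod c)). lra.
      + apply power_sum_mono with (2 := He).
        pose proof (Rmin_r d (rho - Cmod c)). lra. }
  rewrite Ew. apply tends_unique with (psum e u).
  - apply He. lra.
  - set (F := fun v => f (c + v)%C) in Hb.
    exact (power_sum_ext b e d F F Ebe (fun _ _ => eq_refl) Hb u Hu).
Qed.

Lemma Cmod_le_sum z : Cmod z <= Rabs (fst z) + Rabs (snd z).
Proof.
  pose proof (Rabs_pos (fst z)). pose proof (Rabs_pos (snd z)).
  unfold Cmod. rewrite <- (sqrt_pow2 (Rabs (fst z) + Rabs (snd z))) by lra.
  apply sqrt_le_1_alt. rewrite <- (pow2_abs (fst z)), <- (pow2_abs (snd z)). nra.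
Qed.

(** A single number controls both the radius of the local expansion and the
    local bound, so that one application of compactness makes both uniform. *)
Definition tame_at (f : C -> C) (d : R) (c : C) : Prop :=
  (exists b, power_sum b d (fun u => f (c + u)%C)) /\
  (forall u, Cmod u < d -> Cmod (f (c + u)%C) <= / d).

Lemma tame_at_mono f d d' c : 0 < d' <= d -> tame_at f d c -> tame_at f d' c.
Proof.
  intros Hd [[b Hb] H]. split.
  - exists b. apply power_sum_mono with d; [lra|exact Hb].
  - intros u Hu. eapply Rle_trans; [apply H; lra|]. apply Rinv_le_contravar; lra.
Qed.

Lemma tame_near f c :
  (exists rho a, 0 < rho /\ has_expansion f c rho a) ->
  exists d, 0 < d /\ forall c', Cmod (c' - c) < 2 * d -> tame_at f d c'.
Proof.
  intros [rho [a [Hr Ha]]]. apply has_expansion_power_sum in Ha.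
  destruct (expandable_bounded rho (fun w => f (c + w)%C) (rho / 2)) as [B HB];
    [exists a; exact Ha|lra|].
  assert (HB1 : 0 < Rabs B + 1) by (pose proof (Rabs_pos B); lra).
  assert (HBi : 0 < / (Rabs B + 1)) by (apply Rinv_0_lt_compat; exact HB1).
  set (d := Rmin (rho / 8) (/ (Rabs B + 1))).
  assert (Hd : 0 < d) by (apply Rmin_glb_lt; lra).
  assert (Hd1 : d <= rho / 8) by apply Rmin_l.
  assert (Hd2 : d <= / (Rabs B + 1)) by apply Rmin_r.
  exists d. split; [exact Hd|]. intros c' Hc'. split.
  - destruct (power_sum_translate a rho _ (c' - c)%C Ha) as [e [He _]]; [lra|].
    exists e. apply power_sum_ext with e (fun u => f (c + (c' - c + u))%C).
    + reflexivity.
    + intros u _. f_equal. ring.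
    + apply power_sum_mono with (2 := He). lra.
  - intros u Hu. replace (c' + u)%C with (c + (c' - c + u))%C by ring.
    apply Rle_trans with B.
    + apply HB. eapply Rle_trans; [apply Cmod_triangle|lra].
    + pose proof (Rle_abs B). apply Rle_trans with (Rabs B + 1); [lra|].
      rewrite <- (Rinv_inv (Rabs B + 1)). apply Rinv_le_contravar; lra.
Qed.

(** Compactness of a square containing the disc. Centres outside the open unit
    disc get a neighbourhood too small to meet [|c| <= s], where the requirement
    is empty. *)
Lemma tame_uniformly f s :
  analytic_in_disc f -> 0 < s < 1 ->
  exists d, 0 < d /\ forall c, Cmod c <= s -> tame_at f d c.
Proof.
  intros Hf Hs.
  assert (L : forall x y, exists d : posreal, forall c, Cmod c <= s ->
    Rabs (fst c - x) < d -> Rabs (snd c - y) < d -> tame_at f d c).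
  { intros x y.
    assert (Hdist : forall c d, Rabs (fst c - x) < d -> Rabs (snd c - y) < d ->
      Cmod (c - (x, y)) < 2 * d).
    { intros c d H1 H2. eapply Rle_lt_trans; [apply Cmod_le_sum|].
      simpl. unfold Rminus in *. lra. }
    destruct (Rlt_dec (Cmod (x, y)) 1) as [Hxy|Hxy].
    - destruct (tame_near f (x, y) (Hf _ Hxy)) as [d [Hd Hd']].
      exists (mkposreal d Hd). simpl. intros c _ H1 H2. apply Hd', Hdist; assumption.
    - exists (mkposreal ((1 - s) / 2) ltac:(lra)). simpl. intros c Hc H1 H2.
      exfalso. apply Hxy. specialize (Hdist c _ H1 H2).
      pose proof (Cmod_sub_le (x, y) c) as T. rewrite Cmod_minus_sym in T. lra. }
  set (delta := fun x y => proj1_sig (constructive_indefinite_description _ (L x y))).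
  assert (Hdelta : forall x y c, Cmod c <= s -> Rabs (fst c - x) < delta x y ->
    Rabs (snd c - y) < delta x y -> tame_at f (delta x y) c).
  { intros x y. exact (proj2_sig (constructive_indefinite_description _ (L x y))). }
  destruct (compactness_value_2d (-1) 1 (-1) 1 delta) as [d Hd].
  exists d. split; [apply cond_pos|]. intros c Hc.
  pose proof (Rmax_Cmod c) as Hm.
  pose proof (Rmax_l (Rabs (fst c)) (Rabs (snd c))).
  pose proof (Rmax_r (Rabs (fst c)) (Rabs (snd c))).
  destruct (NNPP _ (Hd (fst c) (snd c) ltac:(apply Rabs_le_between; lra)
    ltac:(apply Rabs_le_between; lra))) as [x [y [_ [_ [H1 [H2 H3]]]]]].
  apply tame_at_mono with (delta x y); [split; [apply cond_pos|exact H3]|].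
  apply Hdelta; assumption.
Qed.

(** The gain [d] in [power_sum_extend] is the same at every step as long as the
    disc stays within radius [s], so finitely many steps reach [s]. *)
Lemma analytic_power_sum f :
  analytic_in_disc f -> exists a, power_sum a 1 f.
Proof.
  intros Hf.
  destruct (Hf 0) as [rho [a [Hr Ha]]]; [unfold unit_disc; rewrite Cmod_0; lra|].
  apply has_expansion_power_sum in Ha.
  assert (Ha0 : power_sum a rho f).
  { apply power_sum_ext with (3 := Ha); [reflexivity|]. intros w _. f_equal. ring. }
  exists a. intros w Hw. pose proof (Cmod_ge_0 w).
  set (s := (Cmod w + 1) / 2). assert (Hs : 0 < s < 1) by (unfold s; lra).
  destruct (tame_uniformly f s Hf Hs) as [d [Hd Htame]].
  assert (K : forall k, power_sum a (Rmin s (rho + INR k * d)) f).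
  { induction k as [|k IH].
    - apply power_sum_mono with (2 := Ha0). simpl. rewrite Rmult_0_l, Rplus_0_r.
      apply Rmin_r.
    - set (r := Rmin s (rho + INR k * d)) in *.
      assert (Hr1 : r <= s) by apply Rmin_l.
      assert (Hr0 : 0 < r).
      { apply Rmin_glb_lt; [lra|]. pose proof (pos_INR k). nra. }
      apply power_sum_mono with (r + d).
      + rewrite S_INR. unfold r, Rmin.
        destruct (Rle_dec s (rho + (INR k + 1) * d)), (Rle_dec s (rho + INR k * d)); nra.
      + apply power_sum_extend with (/ d); try assumption.
        * intros c Hc. apply Htame. lra.
        * intros c u Hc Hu. apply Htame; [lra|exact Hu]. }
  destruct (INR_unbounded (s / d)) as [k Hk].
  apply Rlt_div_l in Hk; [|exact Hd].
  apply (K k). apply Rmin_glb_lt; [unfold s; lra|]. unfold s in *. lra.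
Qed.

(** * Bohr's inequality for compositions *)

Theorem theorem6 (h : C -> C) (h_analytic : analytic_in_disc h)
    (h_continuous : continuous_on closed_unit_disc h)
    (r : R) (hr : 0 <= r <= 1 / 3)
    (phi : C -> C) (phi_schwarz : schwarz_function phi) :
  Rbar_le (bohr_operator r (fun z : C => h (phi z))) (sup_norm h).
Proof.
  destruct phi_schwarz as [phi_analytic [phi_0 phi_le]].
  assert (Hcomp : expandable 1 (fun z => h (phi z))).
  { apply expandable_comp_schwarz; try assumption; apply analytic_power_sum; assumption. }
  assert (Hex : exists a, has_expansion (fun z => h (phi z)) 0 1 a).
  { destruct Hcomp as [a Ha]. exists a. apply has_expansion_power_sum.
    apply power_sum_ext with (3 := Ha); [reflexivity|].
    intros w _. rewrite Cplus_0_l. reflexivity. }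
  set (g := fun z => h (phi z)) in *.
  pose proof (epsilon_spec (inhabits (fun _ : nat => RtoC 0)) _ Hex) as Hcoef.
  change (has_expansion g 0 1 (coefficients g)) in Hcoef.
  apply has_expansion_power_sum in Hcoef.
  assert (Hub : forall z, Cmod z <= 1 -> Rbar_le (Cmod (h z)) (sup_norm h)).
  { intros z Hz. unfold sup_norm.
    apply (proj1 (Lub_Rbar_correct
      (fun y => exists z, closed_unit_disc z /\ y = Cmod (h z)))).
    exists z. split; [exact Hz|reflexivity]. }
  destruct (sup_norm h) as [M| |] eqn:EM.
  - unfold bohr_operator. rewrite <- (Lim_seq_const M).
    apply Lim_seq_le_loc. apply filter_forall. intros N.
    apply coefficient_sum_le with (g := g); [|intros w Hw; apply (Hub (phi w)); auto|exact hr].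
    apply power_sum_ext with (3 := Hcoef); [reflexivity|].
    intros w _. rewrite Cplus_0_l. reflexivity.
  - destruct (bohr_operator r g); exact I.
  - exfalso. apply (Hub 0). rewrite Cmod_0. lra.
Qed.
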